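(* Let $M$ be an $n$-dimensional Riemannian manifold, $n\ge 4$, with Riemannian connection $\nabla$ and Riemann curvature tensor $R_{jkl}{}^m$, and let $b_{ij}$ be a symmetric $(0,2)$ tensor field on $M$. Suppose that $b_{ij}$ is a Codazzi tensor, i.e. $\nabla_j b_{kl}=\nabla_k b_{jl}$ or, more generally, that there is a covector field $\beta_k$ on $M$ which is closed, i.e. $\nabla_k\beta_j-\nabla_j\beta_k=0$, such that $b_{ij}$ solves the gauged Codazzi equation $$(\nabla_k -\beta_k)b_{ij} = (\nabla_i-\beta_i)b_{kj}$$ for all indices $i,j,k$. Then $$ b_{im} R_{jkl}{}^m+b_{jm} R_{kil}{}^m+b_{km} R_{ijl}{}^m=0 $$ for all indices $i,j,k,l$.
   Context: $\nabla$ is the Levi-Civita connection of the metric $g_{ij}$; repeated indices are summed. The Riemann tensor convention is $[\nabla_i,\nabla_j]v_k=R_{ijk}{}^m v_m$, so that $[\nabla_i,\nabla_j]b_{kl}=R_{ijk}{}^m b_{ml}+R_{ijl}{}^m b_{km}$, and the Ricci tensor is $R_{kl}=-R_{mkl}{}^m$. The expression $(\nabla_k-\beta_k)b_{ij}$ means $\nabla_k b_{ij}-\beta_k b_{ij}$. All tensor fields are smooth. *)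

(* Defs.v *)
From HB Require Import structures.
From mathcomp Require Import all_boot all_order all_algebra.
From mathcomp Require Import all_classical all_reals all_analysis.

Set Implicit Arguments.
Unset Strict Implicit.
Unset Printing Implicit Defensive.

Import Order.TTheory GRing.Theory Num.Theory.
Import numFieldNormedType.Exports.

Local Open Scope classical_set_scope.
Local Open Scope ring_scope.

(* Tensor fields are given, as in Ricci calculus, by their components in every
   chart; components are functions of the coordinates x : 'rV[R]_n and matter
   only on the (open) image of the chart. *)

Definition basis_vec (R : realType) (n : nat) (i : 'I_n) : 'rV[R]_n :=
  delta_mx 0 i.

Definition pderiv (R : realType) (n : nat) (i : 'I_n) (f : 'rV[R]_n -> R)
    (x : 'rV[R]_n) : R := 'D_(basis_vec R i) f x.

Fixpoint Ck (R : realType) (n : nat) (U : set 'rV[R]_n) (k : nat)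
    (f : 'rV[R]_n -> R) : Prop :=
  (forall x, U x -> {for x, continuous f}) /\
  (if k is k'.+1 then
     forall i : 'I_n, (forall x, U x -> derivable f x (basis_vec R i)) /\
                      Ck U k' (pderiv i f)
   else True).

Definition smooth_on (R : realType) (n : nat) (U : set 'rV[R]_n)
    (f : 'rV[R]_n -> R) : Prop := forall k, Ck U k f.

(* [coord] is relevant only on [dom], and [param] only on [coord @` dom],
   where it is the inverse of [coord]. *)
Record chart (R : realType) (n : nat) (M : topologicalType) := Chart {
  dom : set M;
  coord : M -> 'rV[R]_n;
  param : 'rV[R]_n -> M;
  dom_open : open dom;
  img_open : open (coord @` dom);
  coordK : forall p, dom p -> param (coord p) = p;
  coord_continuous : forall p, dom p -> {for p, continuous coord};
  param_continuous :
    forall x, (coord @` dom) x -> {for x, continuous param} }.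

Definition img (R : realType) (n : nat) (M : topologicalType)
    (c : chart R n M) : set 'rV[R]_n := coord c @` dom c.

Definition overlap (R : realType) (n : nat) (M : topologicalType)
    (c c' : chart R n M) : set 'rV[R]_n := coord c @` (dom c `&` dom c').

Definition transition (R : realType) (n : nat) (M : topologicalType)
    (c c' : chart R n M) (x : 'rV[R]_n) : 'rV[R]_n := coord c' (param c x).

(* The entry (i, j) is d x'^i / d x^j; this is the transpose of the library's
   [jacobian], which acts on row vectors. *)
Definition transition_jac (R : realType) (n : nat) (M : topologicalType)
    (c c' : chart R n M) (x : 'rV[R]_n) : 'M[R]_n :=
  \matrix_(i, j) pderiv j (fun y => transition c c' y 0 i) x.

(* The atlas need not be maximal. *)
Record smooth_manifold (R : realType) (n : nat) := SmoothManifold {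
  carrier :> topologicalType;
  carrier_hausdorff : hausdorff_space carrier;
  carrier_second_countable : @second_countable carrier;
  atlas : set (chart R n carrier);
  atlas_cover : forall p, exists2 c, atlas c & dom c p;
  atlas_smooth : forall c c', atlas c -> atlas c' ->
    forall i, smooth_on (overlap c c') (fun x => transition c c' x 0 i) }.

(* The component of a covector beta is [beta c x 0 i]. *)
Record covector_field (R : realType) (n : nat) (M : smooth_manifold R n) :=
  CovectorField {
  covec :> chart R n M -> 'rV[R]_n -> 'rV[R]_n;
  covec_smooth : forall c, atlas c ->
    forall i, smooth_on (img c) (fun x => covec c x 0 i);
  covec_transform : forall c c', atlas c -> atlas c' ->
    forall x, overlap c c' x -> forall i,
      covec c x 0 i =
      \sum_p covec c' (transition c c' x) 0 p * transition_jac c c' x p i }.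

Record tensor02_field (R : realType) (n : nat) (M : smooth_manifold R n) :=
  Tensor02Field {
  tens :> chart R n M -> 'rV[R]_n -> 'M[R]_n;
  tens_smooth : forall c, atlas c ->
    forall i j, smooth_on (img c) (fun x => tens c x i j);
  tens_transform : forall c c', atlas c -> atlas c' ->
    forall x, overlap c c' x -> forall i j,
      tens c x i j =
      \sum_p \sum_q tens c' (transition c c' x) p q *
        transition_jac c c' x p i * transition_jac c c' x q j }.

Definition symmetric_tensor (R : realType) (n : nat) (M : smooth_manifold R n)
    (b : tensor02_field M) : Prop :=
  forall c x, atlas c -> img c x -> forall i j, b c x i j = b c x j i.

Record riemannian_metric (R : realType) (n : nat) (M : smooth_manifold R n) :=
  RiemannianMetric {
  metric_tensor :> tensor02_field M;
  metric_sym : symmetric_tensor metric_tensor;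
  metric_pos : forall c x, atlas c -> img c x ->
    forall v : 'rV[R]_n, v != 0 ->
      0 < \sum_i \sum_j metric_tensor c x i j * v 0 i * v 0 j }.

(* Below, [g], [v], [b] are component functions in one fixed chart. *)

(* christoffel g m i j x = Gamma^m_{ij}(x) for the Levi-Civita connection. *)
Definition christoffel (R : realType) (n : nat) (g : 'rV[R]_n -> 'M[R]_n)
    (m i j : 'I_n) (x : 'rV[R]_n) : R :=
  2^-1 * \sum_l invmx (g x) m l *
    (pderiv i (fun y => g y j l) x + pderiv j (fun y => g y i l) x
     - pderiv l (fun y => g y i j) x).

(* nabla1 g v i k x = (nabla_i v_k)(x) *)
Definition nabla1 (R : realType) (n : nat) (g : 'rV[R]_n -> 'M[R]_n)
    (v : 'rV[R]_n -> 'rV[R]_n) (i k : 'I_n) (x : 'rV[R]_n) : R :=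
  pderiv i (fun y => v y 0 k) x - \sum_m christoffel g m i k x * v x 0 m.

(* nabla2 g b i k l x = (nabla_i b_kl)(x) *)
Definition nabla2 (R : realType) (n : nat) (g : 'rV[R]_n -> 'M[R]_n)
    (b : 'rV[R]_n -> 'M[R]_n) (i k l : 'I_n) (x : 'rV[R]_n) : R :=
  pderiv i (fun y => b y k l) x
  - \sum_m christoffel g m i k x * b x m l
  - \sum_m christoffel g m i l x * b x k m.

(* nabla_comm g v i j k x = ([nabla_i, nabla_j] v_k)(x) *)
Definition nabla_comm (R : realType) (n : nat) (g : 'rV[R]_n -> 'M[R]_n)
    (v : 'rV[R]_n -> 'rV[R]_n) (i j k : 'I_n) (x : 'rV[R]_n) : R :=
  let nabla_v y := \matrix_(p, q) nabla1 g v p q y in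
  nabla2 g nabla_v i j k x - nabla2 g nabla_v j i k x.

(* riemann g i j k m x = R_{ijk}^m(x), with the sign and index conventions of
   [nabla_i, nabla_j] v_k = R_{ijk}^m v_m : the coefficient R_{ijk}^m is read
   off from the coordinate covector field v = dx^m. *)
Definition riemann (R : realType) (n : nat) (g : 'rV[R]_n -> 'M[R]_n)
    (i j k m : 'I_n) (x : 'rV[R]_n) : R :=
  nabla_comm g (fun=> basis_vec R m) i j k x.

Definition codazzi (R : realType) (n : nat) (M : smooth_manifold R n)
    (g : riemannian_metric M) (b : tensor02_field M) : Prop :=
  forall c x, atlas c -> img c x -> forall j k l,
    nabla2 (g c) (b c) j k l x = nabla2 (g c) (b c) k j l x.

Definition closed_covector (R : realType) (n : nat) (M : smooth_manifold R n)
    (g : riemannian_metric M) (beta : covector_field M) : Prop :=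
  forall c x, atlas c -> img c x -> forall j k,
    nabla1 (g c) (beta c) k j x - nabla1 (g c) (beta c) j k x = 0.

Definition gauged_codazzi (R : realType) (n : nat) (M : smooth_manifold R n)
    (g : riemannian_metric M) (b : tensor02_field M)
    (beta : covector_field M) : Prop :=
  forall c x, atlas c -> img c x -> forall i j k,
    nabla2 (g c) (b c) k i j x - beta c x 0 k * b c x i j =
    nabla2 (g c) (b c) i k j x - beta c x 0 i * b c x k j.

(* Main.v *)
Require Import Defs.
From mathcomp Require Import all_boot all_order all_algebra.
From mathcomp Require Import all_classical all_reals all_analysis.
From mathcomp Require Import ring.

Import Order.TTheory GRing.Theory Num.Theory.
Import numFieldNormedType.Exports.

Local Open Scope classical_set_scope.
Local Open Scope ring_scope.

(** Fix a chart and an index l, and regard b_{il} dx^i as a 1-form omega with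
    values in the cotangent bundle. Since the Levi-Civita connection is torsion
    free, the gauged Codazzi equation says that d^nabla omega = beta /\ omega.
    Applying d^nabla once more, the left side becomes the curvature acting on
    omega, and the right side is
    dbeta /\ omega - beta /\ d^nabla omega = - beta /\ beta /\ omega = 0
    because beta is closed. The vanishing of the curvature term is the asserted
    cyclic identity. The Codazzi equation itself is the case beta = 0.

    In components, torsion freeness ([christoffel_sym]) removes the Christoffel
    symbols carrying both form indices, and the equation reads
    d_k b_il - d_i b_kl = F_kil - F_ikl with
    F_kil = Gamma^m_kl b_im + beta_k b_il. Differentiating along a and
    summing cyclically over (a, k, i), the left side vanishes by the symmetry of
    second partial derivatives ([derive_comm]). What remains is an identity
    between the values at one point of Gamma, b, beta and their first
    derivatives, from which the claim follows by ring operations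
    ([cyclic_codazzi]).

    Two analytic facts support this computation. Symmetry of second derivatives
    is obtained by exhibiting both mixed derivatives as the limit of the same
    second difference quotient ([second_difference_cvg]). The Christoffel
    symbols have partial derivatives ([derivable_christoffel]) because the
    inverse of a matrix is a quotient of polynomials in its entries, and the
    metric is invertible since it is positive definite ([posdef_unitmx]). *)

(** * Symmetry of second directional derivatives *)

Section Schwarz.
Context {R : realType} {V : normedModType R}.
Implicit Types (f : V -> R) (a u v w x : V).

Lemma is_derive_translate f a w u :
  derivable f (a + w) u -> is_derive a u (fun y => f (y + w)) ('D_u f (a + w)).
Proof.
have quotE : (fun h => h^-1 *: (((fun y => f (y + w)) \o shift a) (h *: u)
    - f (a + w))) = (fun h => h^-1 *: ((f \o shift (a + w)) (h *: u) - f (a + w))).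
  by apply/funext => h /=; rewrite addrA.
by move=> df; apply: DeriveDef; rewrite /derivable /derive quotE.
Qed.

Lemma is_derive_line f a u (s : R) :
  derivable f (a + s *: u) u ->
  is_derive s 1 (fun r : R => f (a + r *: u)) ('D_u f (a + s *: u)).
Proof.
have quotE : (fun h : R => h^-1 *: (((fun r : R => f (a + r *: u)) \o shift s)
      (h *: 1) - f (a + s *: u))) =
    (fun h => h^-1 *: ((f \o shift (a + s *: u)) (h *: u) - f (a + s *: u))).
  apply/funext => h /=; rewrite scalerDl [h *: 1]mulr1.
  by congr (_ *: (f _ - _)); rewrite addrCA.
by move=> df; apply: DeriveDef; rewrite /derivable /derive quotE.
Qed.

Lemma MVT_line f a u (t : R) : 0 < t ->
  (forall s, 0 <= s <= t -> derivable f (a + s *: u) u) ->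
  exists2 s, 0 <= s <= t & f (a + t *: u) - f a = t * 'D_u f (a + s *: u).
Proof.
move=> t0 df.
have dfl s : 0 <= s <= t ->
    is_derive s 1 (fun r : R => f (a + r *: u)) ('D_u f (a + s *: u)).
  by move=> /df; exact: is_derive_line.
have [||s /[!in_itv] /andP[s0 st]] :=
    @MVT _ (fun r : R => f (a + r *: u)) (fun r => 'D_u f (a + r *: u)) _ _ t0.
- by move=> s /[!in_itv] /andP[s0 st]; apply: dfl; rewrite !ltW.
- apply: derivable_within_continuous => s /[!in_itv] /= st.
  by have [] := dfl s st.
rewrite scale0r addr0 subr0 mulrC => ->.
by exists s => //; rewrite !ltW.
Qed.

Definition second_difference f x u v (t : R) :=
  f (x + t *: u + t *: v) - f (x + t *: u) - (f (x + t *: v) - f x).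

(** The mean value theorem along u, applied to y |-> f (y + t v) - f y, and then
    along v, applied to 'D_u f, writes the second difference as t^2 times a value
    of 'D_v ('D_u f) at a point of the parallelogram spanned by t u and t v; this
    point tends to x. *)
Lemma second_difference_cvg f x u v :
  (\near x, derivable f x u) -> (\near x, derivable ('D_u f) x v) ->
  {for x, continuous ('D_v ('D_u f))} ->
  t^-1 ^+ 2 * second_difference f x u v t @[t --> 0^'+] --> 'D_v ('D_u f) x.
Proof.
move=> du dvu cvu; apply/cvgrPdist_lt => e e0.
have /nbhs_ballP[d /= d0 near_x] : \forall y \near x, [/\ derivable f y u,
    derivable ('D_u f) y v & `|'D_v ('D_u f) x - 'D_v ('D_u f) y| < e] .
  have near_e : \forall y \near x, `|'D_v ('D_u f) x - 'D_v ('D_u f) y| < e.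
    by move/cvgrPdist_lt : cvu; apply.
  by apply: filterS3 du dvu near_e => y.
(* c bounds the norm of s u + r v for s and r in [0, 1]; the summand 1 keeps it
   positive when u = v = 0. *)
pose c := `|u| + `|v| + 1.
have c0 : 0 < c by rewrite ltr_wpDl// addr_ge0.
have square_sub (t s r : R) : 0 < t -> t < d / c -> 0 <= s <= t -> 0 <= r <= t ->
    ball x d (x + s *: u + r *: v).
  move=> t0 tdc /andP[s0 st] /andP[r0 rt]; rewrite -ball_normE/=.
  rewrite -addrA opprD addrA subrr sub0r normrN.
  rewrite (le_lt_trans (ler_normD _ _))// !normrZ !ger0_norm//.
  rewrite ltr_pdivlMr// in tdc; apply: le_lt_trans tdc.
  rewrite /c !mulrDr mulr1 (@le_trans _ _ (t * `|u| + t * `|v|))//.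
    by rewrite lerD// ler_wpM2r.
  by rewrite lerDl ltW.
near=> t.
have t0 : 0 < t by near: t; exact: nbhs_right_gt.
have tdc : t < d / c by near: t; apply: nbhs_right_lt; rewrite divr_gt0.
have tt : 0 <= t <= t by rewrite lexx ltW.
have zt : 0 <= (0 : R) <= t by rewrite lexx ltW.
have dtr s : 0 <= s <= t -> is_derive (x + s *: u) u
    (fun y => f (y + t *: v) - f y)
    ('D_u f (x + s *: u + t *: v) - 'D_u f (x + s *: u)).
  move=> st; apply: is_deriveB.
    apply: is_derive_translate.
    have [df _ _] := near_x _ (square_sub _ _ _ t0 tdc st tt); exact: df.
  apply: derivableP.
  have := square_sub _ _ _ t0 tdc st zt; rewrite scale0r addr0.
  by move=> /near_x[df _ _]; exact: df.
have [s st eqs] := @MVT_line (fun y => f (y + t *: v) - f y) x u t t0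
  (fun s st => @ex_derive _ _ _ _ _ _ _ (dtr s st)).
have [r rt eqr] := @MVT_line ('D_u f) (x + s *: u) v t t0 (fun r rt =>
  let: And3 _ d2 _ := near_x _ (square_sub _ _ _ t0 tdc st rt) in d2).
rewrite /second_difference.
have -> : f (x + t *: u + t *: v) - f (x + t *: u) - (f (x + t *: v) - f x)
    = t ^+ 2 * 'D_v ('D_u f) (x + s *: u + r *: v).
  by rewrite eqs (@derive_val _ _ _ _ _ _ _ (dtr s st)) eqr mulrA.
rewrite mulrA -exprMn mulVf ?gt_eqF// expr1n mul1r.
by case: (near_x _ (square_sub _ _ _ t0 tdc st rt)).
Unshelve. all: by end_near. Qed.

(** The second difference is symmetric in u and v, so both mixed derivatives are
    the limit of the same quotient. *)
Lemma derive_comm f x u v :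
  (\near x, derivable f x u) -> (\near x, derivable f x v) ->
  (\near x, derivable ('D_u f) x v) -> (\near x, derivable ('D_v f) x u) ->
  {for x, continuous ('D_v ('D_u f))} -> {for x, continuous ('D_u ('D_v f))} ->
  'D_v ('D_u f) x = 'D_u ('D_v f) x.
Proof.
move=> du dv dvu duv cvu cuv.
have luv := second_difference_cvg _ _ _ _ du dvu cvu.
have lvu := second_difference_cvg _ _ _ _ dv duv cuv.
have sdC : second_difference f x v u = second_difference f x u v.
  apply/funext => t; rewrite /second_difference [x + t *: v + _]addrAC.
  ring.
rewrite sdC in lvu.
by rewrite -(cvg_lim (@Rhausdorff R) luv) -(cvg_lim (@Rhausdorff R) lvu).
Qed.
End Schwarz.

(** * Derivability of determinants and inverse matrices *)

Section MatrixDerivability.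
Context {R : realType} {V : normedModType R} {x v : V}.

Lemma is_derive_bigsum n (F : 'I_n -> V -> R) (dF : 'I_n -> R) :
  (forall i, is_derive x v (F i) (dF i)) ->
  is_derive x v (fun y => \sum_i F i y) (\sum_i dF i).
Proof.
move=> dFP; rewrite (_ : (fun y => _) = \sum_i F i); first exact: is_derive_sum.
by apply/funext => y; rewrite fct_sumE.
Qed.

Lemma derivable_bigsum (I : Type) (r : seq I) (F : I -> V -> R) :
  (forall i, derivable (F i) x v) ->
  derivable (fun y => \sum_(i <- r) F i y) x v.
Proof.
move=> dF; elim: r => [|i r IHr].
  by rewrite (_ : (fun y => _) = cst 0);
    [exact: derivable_cst|apply/funext => y; rewrite big_nil].
rewrite (_ : (fun y => _) = F i + (fun y => \sum_(j <- r) F j y)).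
  by apply: derivableD; [exact: dF|exact: IHr].
by apply/funext => y; rewrite big_cons.
Qed.

Lemma derivable_bigprod (I : Type) (r : seq I) (F : I -> V -> R) :
  (forall i, derivable (F i) x v) ->
  derivable (fun y => \prod_(i <- r) F i y) x v.
Proof.
move=> dF; elim: r => [|i r IHr].
  by rewrite (_ : (fun y => _) = cst 1);
    [exact: derivable_cst|apply/funext => y; rewrite big_nil].
rewrite (_ : (fun y => _) = F i * (fun y => \prod_(j <- r) F j y)).
  by apply: derivableM; [exact: dF|exact: IHr].
by apply/funext => y; rewrite big_cons.
Qed.

Lemma derivable_det n (A : V -> 'M[R]_n) :
  (forall i j, derivable (fun y => A y i j) x v) ->
  derivable (fun y => \det (A y)) x v.
Proof.
move=> dA; rewrite /determinant; apply: derivable_bigsum => s.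
apply: (@derivableM _ _ (cst _)); first exact: derivable_cst.
by apply: derivable_bigprod => i.
Qed.

Lemma derivable_cofactor n (A : V -> 'M[R]_n) i j :
  (forall i j, derivable (fun y => A y i j) x v) ->
  derivable (fun y => cofactor (A y) i j) x v.
Proof.
move=> dA; rewrite /cofactor.
apply: (@derivableM _ _ (cst _)); first exact: derivable_cst.
apply: derivable_det => p q.
by rewrite (_ : (fun y => _) = fun y => A y (lift i p) (lift j q))//;
  apply/funext => y; rewrite !mxE.
Qed.

(** Invertibility is needed near x because [invmx] agrees with Cramer's formula
    only on invertible matrices. *)
Lemma derivable_invmx n (A : V -> 'M[R]_n) i j :
  (\forall y \near x, A y \in unitmx) ->
  (forall i j, derivable (fun y => A y i j) x v) ->
  derivable (fun y => invmx (A y) i j) x v.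
Proof.
move=> Au dA.
have Ax := nbhs_singleton Au.
apply: (@near_eq_derivable _ _ _
    ((fun y => (\det (A y))^-1) * (fun y => cofactor (A y) j i))).
  by apply: filterS Au => y uy; rewrite /invmx uy !mxE.
apply: derivableM; last exact: derivable_cofactor.
apply: derivableV; last exact: derivable_det.
by rewrite -unitfE -unitmxE.
Qed.
End MatrixDerivability.

(** A nonzero vector of the kernel would be isotropic. *)
Lemma posdef_unitmx (R : realFieldType) n (A : 'M[R]_n) :
  (forall v : 'rV_n, v != 0 -> 0 < \sum_i \sum_j A i j * v 0 i * v 0 j) ->
  A \in unitmx.
Proof.
move=> Apos; rewrite unitmxE unitfE; apply/det0P => -[v v0 vA0].
suff E : \sum_i \sum_j A i j * v 0 i * v 0 j = 0.
  by have := Apos _ v0; rewrite E ltxx.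
rewrite exchange_big big1// => j _; rewrite -mulr_suml.
have /matrixP/(_ 0 j) := vA0; rewrite !mxE => vAj.
by under eq_bigr do rewrite mulrC; rewrite vAj mul0r.
Qed.

(** * The pointwise algebra of the gauged Codazzi equation *)

(** The variables stand for values at one point: [G p i j] for Gamma^p_ij, and
    [dG a], [db a], [dbeta a] for partial derivatives along the coordinate a. *)
Section CodazziAlgebra.
Context {K : comPzRingType} {n : nat}.
Variables (G : 'I_n -> 'I_n -> 'I_n -> K).
Variables (dG : 'I_n -> 'I_n -> 'I_n -> 'I_n -> K).
Variables (b : 'I_n -> 'I_n -> K) (db : 'I_n -> 'I_n -> 'I_n -> K).
Variables (beta : 'I_n -> K) (dbeta : 'I_n -> 'I_n -> K).

(** The curvature R_ijk^m in terms of the Christoffel symbols, with the sign of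
    [nabla_i, nabla_j] v_k = R_ijk^m v_m. *)
Definition curv i j k m := dG j m i k - dG i m j k
  + \sum_p G p i k * G m j p - \sum_p G p j k * G m i p.

(** The derivative along a of F_kil = Gamma^m_kl b_im + beta_k b_il. By the gauged
    Codazzi equation, F_kil - F_ikl is the exterior derivative of the 1-form
    b_{il} dx^i. *)
Definition dsource a k i l :=
  \sum_m (G m k l * db a i m + b i m * dG a m k l)
  + (beta k * db a i l + b i l * dbeta a k).

Hypothesis dbeta_sym : forall i j, dbeta i j = dbeta j i.
Hypothesis codE : forall k i l, db k i l - db i k l =
  (\sum_m G m k l * b i m + beta k * b i l)
  - (\sum_m G m i l * b k m + beta i * b k l).

(** In the cyclic sum, the derivatives dGamma already have the shape required by
    the curvature. The derivatives of b occur only antisymmetrized, so the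
    Codazzi equation turns them into the quadratic terms of the curvature; its
    own beta terms then cancel those of the product rule, and the terms in dbeta
    cancel by closedness. *)
Lemma cyclic_codazzi i j k l :
  dsource i k j l - dsource i j k l + (dsource j i k l - dsource j k i l)
    + (dsource k j i l - dsource k i j l) = 0 ->
  \sum_m b i m * curv j k l m + \sum_m b j m * curv k i l m
    + \sum_m b k m * curv i j l m = 0.
Proof.
(* W, D, Q and P are the four kinds of contractions that occur. Keeping them as
   atoms leaves an identity without bound indices. *)
pose W k i := \sum_m G m k l * b i m.
pose D a k i := \sum_m b i m * dG a m k l.
pose Q k a i := \sum_m \sum_p G m k l * (G p a m * b i p).
pose P k a i := \sum_m G m k l * db a i m.
have curvE h p q : \sum_m b h m * curv p q l m =
    D q p h - D p q h + (Q p q h - Q q p h).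
  have QE s t : \sum_m b h m * (\sum_r G r s l * G m t r) = Q s t h.
    rewrite /Q exchange_big; apply: eq_bigr => m _; rewrite mulr_sumr.
    by apply: eq_bigr => r _; ring.
  rewrite -!QE -!sumrB -big_split; apply: eq_bigr => m _.
  by rewrite /curv /=; ring.
have dsE a p q : dsource a p q l =
    P p a q + D a p q + (beta p * db a q l + b q l * dbeta a p).
  by rewrite /dsource big_split.
have PE p a q : P p a q =
    P p q a + (Q p a q - Q p q a + (beta a * W p q - beta q * W p a)).
  apply/eqP; rewrite addrC -subr_eq; apply/eqP.
  rewrite /P /Q /W !mulr_sumr -!sumrB -big_split; apply: eq_bigr => m _ /=.
  by rewrite -mulrBr codE -!mulr_sumr; ring.
have dbE p q : db p q l =
    db q p l + (W p q + beta p * b q l - (W q p + beta q * b p l)).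
  by apply/eqP; rewrite addrC -subr_eq; apply/eqP; exact: codE.
rewrite !curvE !dsE (dbeta_sym j i) (dbeta_sym k i) (dbeta_sym k j) => <-.
rewrite (PE k i j) (PE i j k) (PE j k i) (dbE i j) (dbE j k) (dbE k i).
ring.
Qed.
End CodazziAlgebra.

(** * Smooth functions on an open set of coordinates *)

Section SmoothFunctions.
Context {R : realType} {n : nat} {U : set 'rV[R]_n}.
Hypothesis oU : open U.
Implicit Types (f h : 'rV[R]_n -> R) (x : 'rV[R]_n).

Lemma open_near x (P : 'rV[R]_n -> Prop) :
  U x -> (forall y, U y -> P y) -> \forall y \near x, P y.
Proof. by move=> Ux UP; apply: filterS (open_nbhs_nbhs (conj oU Ux)) => y /UP. Qed.

Lemma smooth_derivable f x i :
  smooth_on U f -> U x -> derivable f x (basis_vec R i).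
Proof. by move=> /(_ 1%N)[_ /(_ i)[df _]] /df. Qed.

Lemma smooth_pderiv f i : smooth_on U f -> smooth_on U (pderiv i f).
Proof. by move=> sf k; have [_ /(_ i)[]] := sf k.+1. Qed.

Lemma smooth_continuous f x : smooth_on U f -> U x -> {for x, continuous f}.
Proof. by move=> /(_ 0%N)[cf _] /cf. Qed.

Lemma pderiv_comm f x i j : smooth_on U f -> U x ->
  pderiv i (pderiv j f) x = pderiv j (pderiv i f) x.
Proof.
move=> sf Ux; apply: derive_comm.
- by apply: open_near _ Ux _ => y; exact: smooth_derivable.
- by apply: open_near _ Ux _ => y; exact: smooth_derivable.
- by apply: open_near _ Ux _ => y; apply/smooth_derivable/smooth_pderiv.
- by apply: open_near _ Ux _ => y; apply/smooth_derivable/smooth_pderiv.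
- by apply: smooth_continuous Ux; do 2 apply: smooth_pderiv.
- by apply: smooth_continuous Ux; do 2 apply: smooth_pderiv.
Qed.

Lemma eq_pderiv f h x i :
  U x -> (forall y, U y -> f y = h y) -> pderiv i f x = pderiv i h x.
Proof.
move=> Ux fh; apply: near_eq_derive.
by apply: open_near _ Ux _ => y /fh.
Qed.
End SmoothFunctions.

(** * Curvature and the gauged Codazzi equation in a chart *)

Section ChartCurvature.
Context {R : realType} {n : nat} {U : set 'rV[R]_n}.
Variable g : 'rV[R]_n -> 'M[R]_n.
Hypotheses (oU : open U) (g_smooth : forall i j, smooth_on U (fun y => g y i j)).
Hypothesis g_sym : forall x, U x -> forall i j, g x i j = g x j i.
Hypothesis g_unit : forall x, U x -> g x \in unitmx.

Lemma christoffel_sym x m i j :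
  U x -> christoffel g m i j x = christoffel g m j i x.
Proof.
move=> Ux; rewrite /christoffel; congr (_ * _).
apply: eq_bigr => l _; congr (_ * _).
have gE : pderiv l (fun y => g y i j) x = pderiv l (fun y => g y j i) x.
  by apply: (eq_pderiv oU _ _ _ _ Ux) => y /g_sym.
by rewrite gE; congr (_ - _); rewrite addrC.
Qed.

Variable x : 'rV[R]_n.
Hypothesis Ux : U x.

Lemma derivable_christoffel m i j a :
  derivable (christoffel g m i j) x (basis_vec R a).
Proof.
rewrite /christoffel; apply: (@derivableM _ _ (cst _)); first exact: derivable_cst.
apply: derivable_bigsum => l; apply: derivableM.
  apply: derivable_invmx; first by apply: (open_near oU _ _ Ux) => y /g_unit.
  by move=> p q; apply: smooth_derivable Ux.
have dg p q r : derivable (pderiv p (fun y => g y q r)) x (basis_vec R a).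
  by apply: smooth_derivable Ux; exact: smooth_pderiv.
by apply: derivableB => //; apply: derivableD.
Qed.

Lemma nabla1_coord m i k y :
  nabla1 g (fun=> basis_vec R m) i k y = - christoffel g m i k y.
Proof.
rewrite /nabla1 /pderiv [X in X - _]derive_cst sub0r; congr (- _).
rewrite (bigD1 m)//= big1 => [|p pm]; rewrite /basis_vec mxE !eqxx/=.
  by rewrite mulr1 addr0.
by rewrite (negPf pm) mulr0.
Qed.

(** The second covariant derivative of dx^m contains Gamma^s_ij Gamma^m_sk, which
    disappears from the commutator because Gamma^s_ij is symmetric in i and j. *)
Lemma riemannE i j k m : riemann g i j k m x =
  curv (fun p q r => christoffel g p q r x)
    (fun a p q r => pderiv a (christoffel g p q r) x) i j k m.
Proof.
have nabla_dx p q r : nabla2 g (fun y => \matrix_(s, t)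
      nabla1 g (fun=> basis_vec R m) s t y) p q r x =
    - pderiv p (christoffel g m q r) x
    - - (\sum_s christoffel g s p q x * christoffel g m s r x)
    - - (\sum_s christoffel g s p r x * christoffel g m q s x).
  rewrite /nabla2; congr (_ - _ - _).
  - transitivity (pderiv p (- christoffel g m q r) x).
      apply: (eq_pderiv oU _ _ _ _ Ux) => y _.
      by rewrite mxE; exact: nabla1_coord.
    by apply: deriveN; exact: derivable_christoffel.
  - by rewrite -sumrN; apply: eq_bigr => s _; rewrite mxE nabla1_coord mulrN.
  - by rewrite -sumrN; apply: eq_bigr => s _; rewrite mxE nabla1_coord mulrN.
have torsion : \sum_s christoffel g s j i x * christoffel g m s k x =
    \sum_s christoffel g s i j x * christoffel g m s k x.
  by apply: eq_bigr => s _; rewrite christoffel_sym.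
(* T is the torsion term; P and Q are the quadratic terms of the curvature. *)
have cancel (A B T P Q : R) :
  - A - - T - - P - (- B - - T - - Q) = B - A + P - Q by ring.
rewrite /riemann /nabla_comm !nabla_dx torsion.
exact: cancel.
Qed.

Variables (b : 'rV[R]_n -> 'M[R]_n) (beta : 'rV[R]_n -> 'rV[R]_n).
Hypothesis b_smooth : forall i j, smooth_on U (fun y => b y i j).
Hypothesis beta_derivable : forall i a,
  derivable (fun y => beta y 0 i) x (basis_vec R a).

(** The gauged Codazzi equation is assumed on all of U because the proof
    differentiates it at x. *)
Lemma gauged_codazzi_curvature :
  (forall j k, pderiv k (fun y => beta y 0 j) x =
    pderiv j (fun y => beta y 0 k) x) ->
  (forall y, U y -> forall i j k,
    nabla2 g b k i j y - beta y 0 k * b y i j =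
    nabla2 g b i k j y - beta y 0 i * b y k j) ->
  forall i j k l, \sum_m b x i m * riemann g j k l m x
  + \sum_m b x j m * riemann g k i l m x
  + \sum_m b x k m * riemann g i j l m x = 0.
Proof.
move=> beta_closed cod i j k l.
pose Gam p q r := christoffel g p q r x.
pose dGam a p q r := pderiv a (christoffel g p q r) x.
pose db a p q := pderiv a (fun y => b y p q) x.
pose dbeta a p := pderiv a (fun y => beta y 0 p) x.
have -> : \sum_m b x i m * riemann g j k l m x
    + \sum_m b x j m * riemann g k i l m x
    + \sum_m b x k m * riemann g i j l m x =
    \sum_m b x i m * curv Gam dGam j k l m
    + \sum_m b x j m * curv Gam dGam k i l m
    + \sum_m b x k m * curv Gam dGam i j l m.
  by congr (_ + _ + _); apply: eq_bigr => m _; rewrite riemannE.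
pose source p q r y :=
  \sum_m christoffel g m p r y * b y q m + beta y 0 p * b y q r.
have codE y : U y -> forall p q r, pderiv p (fun z => b z q r) y -
    pderiv q (fun z => b z p r) y = source p q r y - source q p r y.
  move=> Uy p q r; have /eqP := cod _ Uy q r p; rewrite /nabla2 /source.
  under [X in _ - X - _ - _ == _]eq_bigr do rewrite christoffel_sym//.
  by rewrite -subr_eq0 => /eqP H; apply/eqP; rewrite -subr_eq0 -[X in _ == X]H;
    apply/eqP; ring.
have dsourceE a p q r : is_derive x (basis_vec R a) (source p q r)
    (dsource Gam dGam (b x) db (beta x 0) dbeta a p q r).
  have dP := derivable_christoffel.
  apply: is_deriveD; last first.
    apply: is_deriveM; apply: derivableP; first exact: beta_derivable.
    exact: smooth_derivable Ux.
  apply: is_derive_bigsum => m.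
  apply: is_deriveM; apply: derivableP; first exact: dP.
  exact: smooth_derivable Ux.
(* This is the Codazzi equation differentiated along a. *)
have source_swap a p q r :
    dsource Gam dGam (b x) db (beta x 0) dbeta a p q r -
    dsource Gam dGam (b x) db (beta x 0) dbeta a q p r =
    pderiv a (pderiv p (fun z => b z q r)) x -
    pderiv a (pderiv q (fun z => b z p r)) x.
  have ddb s t u : derivable (pderiv s (fun z => b z t u)) x (basis_vec R a).
    by apply: smooth_derivable Ux; exact: smooth_pderiv.
  have [ds1 <-] := dsourceE a p q r; have [ds2 <-] := dsourceE a q p r.
  transitivity (pderiv a (source p q r - source q p r) x).
    by apply/esym/deriveB; [exact: ds1|exact: ds2].
  transitivity (pderiv a (pderiv p (fun z => b z q r) -
      pderiv q (fun z => b z p r)) x); last by apply: deriveB; exact: ddb.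
  by apply: (eq_pderiv oU _ _ _ _ Ux) => y Uy; apply/esym/codE.
apply: (cyclic_codazzi _ _ _ db (beta x 0) dbeta).
- by move=> p q; exact: beta_closed.
- by move=> p r q; exact: codE.
rewrite !source_swap (pderiv_comm oU _ _ j i)// (pderiv_comm oU _ _ k i)//.
rewrite (pderiv_comm oU _ _ k j)//.
have cancel (A B C : R) : A - B + (B - C) + (C - A) = 0 by ring.
exact: cancel.
Qed.
End ChartCurvature.

(** * The curvature identity *)

Theorem proposition2p4 (R : realType) (n : nat) (n_ge4 : (4 <= n)%N)
    (M : smooth_manifold R n) (g : riemannian_metric M)
    (b : tensor02_field M) (b_sym : symmetric_tensor b)
    (b_codazzi : codazzi g b \/
       exists beta : covector_field M,
         closed_covector g beta /\ gauged_codazzi g b beta)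
    (c : chart R n M) (x : 'rV[R]_n) (c_atlas : atlas c) (x_img : img c x)
    (i j k l : 'I_n) :
  \sum_m b c x i m * riemann (g c) j k l m x
  + \sum_m b c x j m * riemann (g c) k i l m x
  + \sum_m b c x k m * riemann (g c) i j l m x = 0.
Proof.
have oU : open (img c) := @img_open _ _ _ c.
have g_smooth := @tens_smooth _ _ _ g c c_atlas.
have g_sym y : img c y -> forall i j, g c y i j = g c y j i.
  by move=> Uy; exact: (@Defs.metric_sym _ _ _ g c y c_atlas Uy).
have g_unit y : img c y -> g c y \in unitmx.
  by move=> Uy; apply: posdef_unitmx; exact: (@metric_pos _ _ _ g c y c_atlas Uy).
have b_smooth := @tens_smooth _ _ _ b c c_atlas.
have [cod|[beta [beta_closed cod]]] := b_codazzi.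
  apply: (gauged_codazzi_curvature _ oU g_smooth g_sym g_unit _ x_img
    _ (fun=> 0) b_smooth).
  - by move=> p a; exact: derivable_cst.
  - by move=> p q; rewrite /pderiv !derive_cst.
  - by move=> y Uy p q r; rewrite !mxE !mul0r !subr0; exact: cod.
apply: (gauged_codazzi_curvature _ oU g_smooth g_sym g_unit _ x_img
  _ (beta c) b_smooth).
- by move=> p a; apply: smooth_derivable x_img; exact: covec_smooth.
- move=> p q; have /eqP := beta_closed _ _ c_atlas x_img p q.
  rewrite subr_eq0 /nabla1 => /eqP.
  under [X in _ - X = _]eq_bigr do
    rewrite (christoffel_sym _ oU g_sym _ _ _ _ x_img).
  by move/addIr.
- by move=> y Uy; exact: cod.
Qed.
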